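(* Let $A$ be a unital $C^*$-algebra and let $a\in A$ be such that $a^{\dag}$ exists. Suppose that there exist $b,c\in A$ such that $a=bc$, $b^{-1}(0)=0$ and $cA=A$. Then the following statements are equivalent: (i) $a$ is EP; (ii) $a^*a=c^*b^*bcbb^{\dag}$ and $a^*a=c^*b^*c^{\dag}cbc$; (iii) $aa^*=bcc^*b^*c^*(c^* )^{\dag}$ and $aa^*=bcbb^{\dag}c^*b^*$; (iv) $a^*a=c^*b^*bcbb^{\dag}$ and $aa^*=bcc^*b^*c^*(c^* )^{\dag}$; (v) $aa^*=c^{\dag}b^{\dag}bcbcc^*b^*$ and $a^*a=c^*b^*bcbb^{\dag}$; (vi) $a^*a=bcc^{\dag}b^{\dag}c^*b^*bc$ and $aa^*=bcc^*b^*c^*(c^* )^{\dag}$; (vii) $aa^*=c^{\dag}b^{\dag}bcbcc^*b^*$ and $a^*a=bcc^{\dag}b^{\dag}c^*b^*bc$.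
   Context: For $x\in A$: $x^{-1}(0)=\{y\in A: xy=0\}$ and $xA=\{xy:y\in A\}$. The Moore-Penrose inverse of $a\in A$, if it exists, is the (unique) $x\in A$ with $a=axa$, $x=xax$ and $ax$, $xa$ self-adjoint; it is denoted $a^{\dag}$. An element $a$ is EP if $a^{\dag}$ exists and $aa^{\dag}=a^{\dag}a$. Under the hypotheses of the claim, the Moore-Penrose inverses $b^{\dag}$, $c^{\dag}$ and $(c^* )^{\dag}=(c^{\dag})^*$ exist in $A$. *)

(* Defs.v *)
From HB Require Import structures.
From mathcomp Require Import all_boot all_order all_algebra.
From mathcomp Require Import complex.
From mathcomp Require Import all_classical all_reals all_analysis.
Import Order.TTheory GRing.Theory Num.Theory.
Import numFieldNormedType.Exports.

Set Implicit Arguments.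
Unset Strict Implicit.
Unset Printing Implicit Defensive.

Local Open Scope classical_set_scope.
Local Open Scope ring_scope.

Reserved Notation "x ^†" (at level 1, left associativity, format "x ^†").
Reserved Notation "x ^⋆" (at level 1, left associativity, format "x ^⋆").

(* Unital complex C*-algebras, with R[i] as the field of complex numbers.  The
   norm takes its values in R[i], as for every normedModType over R[i]; these
   values are nonnegative reals.  The multiplication is part of the mixin, and
   the ring structure is derived from it below, because Hierarchy Builder
   cannot join a ring structure with the normed modules: their only common
   heirs are the numDomainTypes.  The zero algebra (1 = 0) is allowed. *)
HB.mixin Record isCStarAlgebra (R : realType) A
    of CompleteNormedModule R[i] A := {
  cstar_one : A ;
  cstar_mul : A -> A -> A ;
  star : A -> A ;
  cstar_mulA : associative cstar_mul ;
  cstar_mul1l : left_id cstar_one cstar_mul ;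
  cstar_mul1r : right_id cstar_one cstar_mul ;
  cstar_mulDl : left_distributive cstar_mul +%R ;
  cstar_mulDr : right_distributive cstar_mul +%R ;
  cstar_scalerAl : forall (k : R[i]) (x y : A),
    k *: cstar_mul x y = cstar_mul (k *: x) y ;
  cstar_scalerAr : forall (k : R[i]) (x y : A),
    k *: cstar_mul x y = cstar_mul x (k *: y) ;
  cstar_normM : forall x y : A, `|cstar_mul x y| <= `|x| * `|y| ;
  starK : involutive star ;
  starD : {morph star : x y / x + y} ;
  starZ : forall (k : R[i]) (x : A), star (k *: x) = conjc k *: star x ;
  cstar_starM : forall x y : A,
    star (cstar_mul x y) = cstar_mul (star y) (star x) ;
  cstar_norm : forall x : A, `|cstar_mul (star x) x| = `|x| ^+ 2
}.

#[short(type="cstarAlgType")]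
HB.structure Definition CStarAlgebra (R : realType) :=
  {A of CompleteNormedModule R[i] A & isCStarAlgebra R A}.

HB.instance Definition _ (R : realType) (A : cstarAlgType R) :=
  GRing.Zmodule_isPzRing.Build A
    cstar_mulA cstar_mul1l cstar_mul1r cstar_mulDl cstar_mulDr.

Lemma starM (R : realType) (A : cstarAlgType R) (x y : A) :
  star (x * y) = star y * star x.
Proof. exact: cstar_starM. Qed.

(* The usual notation for the adjoint is taken by Num.conj in ring_scope. *)
Notation "x ^⋆" := (star x) : ring_scope.

Section MoorePenrose.
Context {R : realType} {A : cstarAlgType R}.
Implicit Types a b c x y : A.

(* x^{-1}(0) *)
Definition rann x : set A := [set y | x * y = 0].

(* xA *)
Definition rideal x : set A := [set x * y | y in [set: A]].

Definition self_adjoint x : Prop := x^⋆ = x.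

Definition is_mpinv a x : Prop :=
  [/\ a = a * x * a, x = x * a * x, self_adjoint (a * x) & self_adjoint (x * a)].

Definition mp_invertible a : Prop := exists x, is_mpinv a x.

(* A total function: by mpinvP and mpinv_unique below it is the Moore-Penrose
   inverse of a whenever there is one, and it is 0 otherwise. *)
Definition mpinv a : A := xget 0 [set x | is_mpinv a x].

Local Notation "x ^†" := (mpinv x) : ring_scope.

Definition EP a : Prop := mp_invertible a /\ a * a^† = a^† * a.

Lemma mpinvP a : mp_invertible a -> is_mpinv a a^†.
Proof. by move=> [x ax]; exact: (xgetPex 0 (ex_intro _ x ax)). Qed.

Lemma mpinv_unique a x y : is_mpinv a x -> is_mpinv a y -> x = y.
Proof.
move=> [ax xa sax sxa] [ay ya say sya].
have eqr : a * x = a * y.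
  rewrite -[LHS]sax {1}ay -mulrA starM sax say.
  by rewrite mulrA -ax.
have eql : x * a = y * a.
  rewrite -[LHS]sxa {1}ay -[a * y * a]mulrA mulrA starM sxa sya.
  by rewrite -mulrA [a * (x * a)]mulrA -ax.
by rewrite xa -mulrA eqr mulrA eql -ya.
Qed.

Lemma mpinvE a x : is_mpinv a x -> a^† = x.
Proof. by move=> ax; apply: (mpinv_unique _ ax); apply: mpinvP; exists x. Qed.

Lemma is_mpinv_star a x : is_mpinv a x -> is_mpinv a^⋆ x^⋆.
Proof.
move=> [ax xa sax sxa]; split.
- by rewrite -!starM mulrA -ax.
- by rewrite -!starM mulrA -xa.
- by rewrite /self_adjoint -starM sxa.
- by rewrite /self_adjoint -starM sax.
Qed.

(* The Moore-Penrose inverses of the two factors exist, so that no default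
   value of mpinv occurs under these hypotheses. *)
Lemma mpinv_factors a b c : mp_invertible a -> a = b * c ->
  rann b = [set 0] -> rideal c = [set: A] ->
  is_mpinv b (c * a^†) /\ is_mpinv c (a^† * b).
Proof.
move=> /mpinvP [aE xE sl sr] abc b0 cA; set x := a^† in aE xE sl sr *.
have [d _ cd] : rideal c 1 by rewrite cA.
have cxa : c * x * a = c.
  apply/subr0_eq; have : rann b (c * x * a - c).
    by rewrite /rann /= mulrBr !mulrA -abc -aE subrr.
  by rewrite b0.
have cxb : c * x * b = 1 by rewrite -cd -[in RHS]cxa abc -!mulrA cd mulr1.
split; split.
- by rewrite -!mulrA [c * (x * b)]mulrA cxb mulr1.
- by rewrite cxb mul1r.
- by rewrite mulrA -abc.
- by rewrite /self_adjoint cxb -[LHS]mulr1 -{2}[1]starK -starM mulr1 starK.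
- by rewrite mulrA cxb mul1r.
- by rewrite -!mulrA [c * (x * b)]mulrA cxb mulr1.
- by rewrite /self_adjoint mulrA cxb -[LHS]mulr1 -{2}[1]starK -starM mulr1 starK.
- by rewrite -mulrA -abc.
Qed.

End MoorePenrose.

Notation "x ^†" := (mpinv x) : ring_scope.

(* Main.v *)
Require Import Defs.
From HB Require Import structures.
From mathcomp Require Import all_boot all_order all_algebra.
From mathcomp Require Import complex.
From mathcomp Require Import all_classical all_reals all_analysis.
Import Order.TTheory GRing.Theory Num.Theory.
Import numFieldNormedType.Exports.

Local Open Scope classical_set_scope.
Local Open Scope ring_scope.

(* Put p = a a^† = b b^† and q = a^† a = c^† c.  Rewritten with p and q, each
   identity in (ii)-(vii) is one of a^* a = a^* a p, a^* a = p a^* a and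
   a a^* = a p a^*, all equivalent to a p = a, or one of a a^* = a a^* q,
   a a^* = q a a^* and a^* a = a^* q a, all equivalent to q a = a; every item
   contains one of each kind.  Finally a p = a means q p = q and q a = a means
   q p = p, so that both together say p = q, i.e. that a is EP. *)

Section StarAlgebra.
Set Implicit Arguments.
Context {R : realType} {A : cstarAlgType R}.
Implicit Types a e w x y : A.

Lemma starB x y : (x - y)^⋆ = x^⋆ - y^⋆.
Proof. by apply/eqP; rewrite -subr_eq opprK -starD subrK. Qed.

(** The C*-identity gives [|x|^2 = 0]. *)
Lemma star_mul_eq0 x : x^⋆ * x = 0 -> x = 0.
Proof.
move=> x0; have := cstar_norm x; rewrite [cstar_mul _ _]x0 normr0.
by move/esym/eqP; rewrite expf_eq0 /= normr_eq0 => /eqP.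
Qed.

(** For a projection [e], the element [d = w - e w] satisfies [d^⋆ d = w^⋆ w - w^⋆ e w], so the
    first equation forces [d = 0]. *)
Lemma projection_fixP e w : self_adjoint e -> e * e = e ->
  w^⋆ * w = w^⋆ * e * w <-> e * w = w.
Proof.
move=> se ee; split=> [weq|ew]; last by rewrite -mulrA ew.
apply/esym/subr0_eq/star_mul_eq0.
rewrite starB starM se mulrBr !mulrBl -weq.
by rewrite !mulrA -[w^⋆ * e * e]mulrA ee weq !subrr.
Qed.

Lemma projection_fix_starP e w : self_adjoint e -> e * e = e ->
  w * w^⋆ = w * e * w^⋆ <-> w * e = w.
Proof.
move=> se ee; have := projection_fixP w^⋆ se ee; rewrite starK => ->.
by split=> /(congr1 star); rewrite !starM ?starK se.
Qed.

Section MoorePenroseInverse.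
Variables a x : A.
Hypothesis ax : is_mpinv a x.

Lemma is_mpinv_sym : is_mpinv x a.
Proof. by case: ax. Qed.

Lemma mpinv_idem : a * x * (a * x) = a * x.
Proof. by case: ax => aE _ _ _; rewrite mulrA -aE. Qed.

(** Multiplication by [x^⋆] on the left cancels [a^⋆], because [x^⋆ a^⋆ = (a x)^⋆ = a x] and
    [a x a = a]. *)
Lemma star_mul_cancel y : a^⋆ * a = a^⋆ * a * y <-> a * y = a.
Proof.
have [aE _ sax _] := ax; have xa : x^⋆ * a^⋆ * a = a by rewrite -starM sax -aE.
split=> [eq_y|ay]; last by rewrite -mulrA ay.
by rewrite -xa -{1}mulrA -{1}mulrA [a^⋆ * (a * y)]mulrA -eq_y mulrA.
Qed.

(** Since [a^⋆ a] and [y] are self-adjoint, taking adjoints moves [y] to the right-hand side of the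
    product. *)
Lemma star_mul_cancel_left y : self_adjoint y ->
  a^⋆ * a = y * (a^⋆ * a) <-> a * y = a.
Proof.
move=> sy; rewrite -star_mul_cancel.
by split=> /(congr1 star); rewrite !starM ?starK sy.
Qed.

End MoorePenroseInverse.

Lemma mul_star_cancel a x y : is_mpinv a x -> self_adjoint y ->
  a * a^⋆ = a * a^⋆ * y <-> y * a = a.
Proof.
move=> /is_mpinv_star ax sy; have := star_mul_cancel ax y; rewrite starK => ->.
by split=> /(congr1 star); rewrite !starM ?starK sy.
Qed.

Lemma mul_star_cancel_left a x y : is_mpinv a x -> self_adjoint y ->
  a * a^⋆ = y * (a * a^⋆) <-> y * a = a.
Proof.
move=> ax sy; rewrite -(mul_star_cancel ax sy).
by split=> /(congr1 star); rewrite !starM ?starK sy.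
Qed.

Lemma EP_projectionsP a x : is_mpinv a x ->
  EP a <-> a * (a * x) = a /\ x * a * a = a.
Proof.
move=> ax; have [aE xE sax sxa] := ax; rewrite /EP (mpinvE ax); split.
  (* Once [a x = x a], both equations reduce to [a = a x a]. *)
  by move=> [_ eq_xa]; rewrite -eq_xa -aE eq_xa mulrA -aE.
move=> [ap qa]; split; first by exists x.
have qp : x * a * (a * x) = x * a by rewrite -mulrA ap.
by rewrite -qp mulrA qa.
Qed.

End StarAlgebra.

Theorem theorem3p10 (R : realType) (A : cstarAlgType R) (a b c : A)
    (ha : mp_invertible a) (habc : a = b * c)
    (hb : rann b = [set 0]) (hc : rideal c = [set: A]) :
  [<->
    (* i *) EP a;
    (* ii *)
      a^⋆ * a = c^⋆ * b^⋆ * b * c * b * b^† /\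
      a^⋆ * a = c^⋆ * b^⋆ * c^† * c * b * c;
    (* iii *)
      a * a^⋆ = b * c * c^⋆ * b^⋆ * c^⋆ * (c^⋆)^† /\
      a * a^⋆ = b * c * b * b^† * c^⋆ * b^⋆;
    (* iv *)
      a^⋆ * a = c^⋆ * b^⋆ * b * c * b * b^† /\
      a * a^⋆ = b * c * c^⋆ * b^⋆ * c^⋆ * (c^⋆)^†;
    (* v *)
      a * a^⋆ = c^† * b^† * b * c * b * c * c^⋆ * b^⋆ /\
      a^⋆ * a = c^⋆ * b^⋆ * b * c * b * b^†;
    (* vi *)
      a^⋆ * a = b * c * c^† * b^† * c^⋆ * b^⋆ * b * c /\
      a * a^⋆ = b * c * c^⋆ * b^⋆ * c^⋆ * (c^⋆)^†;
    (* vii *)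
      a * a^⋆ = c^† * b^† * b * c * b * c * c^⋆ * b^⋆ /\
      a^⋆ * a = b * c * c^† * b^† * c^⋆ * b^⋆ * b * c].
Proof.
have [bB cC] := mpinv_factors ha habc hb hc.
have ax := mpinvP ha; have [aE _ sp sq] := ax.
(* With [x = a^†], the three inverses become explicit: [b^† = c x], [c^† = x b] and
   [(c^⋆)^† = (x b)^⋆]. *)
rewrite (mpinvE bB) (mpinvE cC) (mpinvE (is_mpinv_star cC)).
set x := a^† in bB cC ax aE sp sq *.
have as_ : c^⋆ * b^⋆ = a^⋆ by rewrite -starM -habc.
have bp : b * (c * x) = a * x by rewrite mulrA -habc.
have cq : x * b * c = x * a by rewrite -mulrA -habc.
have cqs : c^⋆ * (x * b)^⋆ = x * a by rewrite -starM cq sq.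
have ii1 : c^⋆ * b^⋆ * b * c * b * (c * x) = a^⋆ * a * (a * x).
  by rewrite as_ -[_ * b * c]mulrA -habc -[_ * b * _]mulrA bp.
have ii2 : c^⋆ * b^⋆ * (x * b) * c * b * c = a^⋆ * (x * a) * a.
  by rewrite as_ -[_ * b * c]mulrA -habc -[_ * (x * b) * c]mulrA cq.
have iii1 : b * c * c^⋆ * b^⋆ * c^⋆ * (x * b)^⋆ = a * a^⋆ * (x * a).
  by rewrite -habc -[a * _ * _]mulrA as_ -[_ * c^⋆ * _]mulrA cqs.
have iii2 : b * c * b * (c * x) * c^⋆ * b^⋆ = a * (a * x) * a^⋆.
  by rewrite -habc -[a * b * _]mulrA bp -[_ * c^⋆ * _]mulrA as_.
(* Here [c^† b^† = x b c x = x a x = x], the reverse order law; it also underlies [vi1]. *)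
have v1 : x * b * (c * x) * b * c * b * c * c^⋆ * b^⋆ = x * a * (a * a^⋆).
  rewrite -[_ * c^⋆ * _]mulrA as_ -[x * b * _]mulrA bp mulrA.
  rewrite -![_ * b * c]mulrA -habc -[x * a * x * a]mulrA.
  by rewrite -[x * a * (x * a)]mulrA [a * (x * a)]mulrA -aE !mulrA.
have vi1 : b * c * (x * b) * (c * x) * c^⋆ * b^⋆ * b * c = a * x * (a^⋆ * a).
  rewrite -[_ * c^⋆ * _]mulrA as_ -[_ * b * c]mulrA -habc.
  by rewrite -[a * (x * b) * _]mulrA -[x * b * _]mulrA bp !mulrA -aE.
rewrite {}ii1 {}ii2 {}iii1 {}iii2 {}v1 {}vi1.
have fixp := star_mul_cancel ax (a * x).
have fixpl := star_mul_cancel_left ax sp.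
have fixq := mul_star_cancel ax sq.
have fixql := mul_star_cancel_left ax sq.
have fixqm := projection_fixP a sq (mpinv_idem (is_mpinv_sym ax)).
have fixpm := projection_fix_starP a sp (mpinv_idem ax).
(* Every item turns into the conjunction of [a p = a] and [q a = a], in one order or the other. *)
tfae; rewrite ?(EP_projectionsP ax) ?fixp ?fixpl ?fixq ?fixql ?fixqm ?fixpm.
all: by case.
Qed.
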